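(* Let $(X,d)$ be a metric space, regarded as a uniform space $(X,\mathcal U)$ with the uniformity $\mathcal U$ induced by $d$. The following ten conditions are equivalent: (i) $U(X)$ is a ring, i.e. $fg\in U(X)$ for all $f,g\in U(X)$; (ii) for every $f\in U(X)$ and every $g\in U^*(X)$, the product $fg$ is proximally continuous; (iii) for every $f\in U(X)$ there is $k\ge 0$ such that $\{x\in X:|f(x)|\ge k\}$ is uniformly isolated in $X$; (iv) for every $f\in U(X)$ there is $k\ge 0$ such that $f$ is uniformly locally constant on $I=\{x\in X:|f(x)|\ge k\}$, i.e. there is $U\in\mathcal U$ such that $f(U[x])=\{f(x)\}$ for every $x\in I$; (v) for every $f\in U(X)$ and every continuous $g:\mathbb R\to\mathbb R$, $g\circ f\in U(X)$; (vi) every unbounded set in $X$ contains an infinite uniformly isolated set; (vii) for every unbounded set $B\subset X$ there are $U\in\mathcal U$ and an infinite set $A\subset B$ such that $U[A]\subset B$; (viii) for every $U\in\mathcal U$ there are a bounded set $B\subset X$ and $n\in\mathbb N$ such that $X\setminus U^n[B]$ is uniformly discrete; (ix) for every $U\in\mathcal U$ there are a bounded set $B\subset X$ and $n\in\mathbb N$ such that $X\setminus U^n[B]$ is uniformly isolated; (x) there is a bounded set $B\subset X$ such that for every $U\in\mathcal U$ there is $n\in\mathbb N$ such that $X\setminus U^n[B]$ is uniformly isolated.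
   Context: $U(X)$ is the set of all real-valued uniformly continuous functions on $X$ ($\mathbb R$ with its usual uniformity) and $U^*(X)$ the set of bounded members of $U(X)$; products are pointwise. $\mathbb N$ denotes the positive integers. All entourages $U\in\mathcal U$ considered are assumed open and symmetric. For $U\in\mathcal U$, $F\subset X$, $n\in\mathbb N$: $U^n=U\circ\cdots\circ U$ ($n$ times), $U[F]=\{x\in X:(x,y)\in U\text{ for some }y\in F\}$, and $U[x]=U[\{x\}]$. A set $B\subset X$ is (Bourbaki) bounded in $X$ if every $f\in U(X)$ is bounded on $B$ (equivalently, for every $U\in\mathcal U$ there are $n\in\mathbb N$ and a finite $F\subset X$ with $B\subset U^n[F]$); otherwise it is unbounded. A set $A\subset X$ is uniformly isolated in $X$ if there is $U\in\mathcal U$ with $U[x]=\{x\}$ for every $x\in A$. A set $A\subset X$ is uniformly discrete if there is $U\in\mathcal U$ with $U[x]\cap A=\{x\}$ for every $x\in A$. A function $f:X\to\mathbb R$ is proximally continuous if for every $A\subset X$ and $\varepsilon>0$ there is $U\in\mathcal U$ such that $f(U[A])\subset B(f(A),\varepsilon)$, where $B(f(A),\varepsilon)$ is the $\varepsilon$-enlargement of $f(A)$ in $\mathbb R$. *)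

(* Defs.v *)
From HB Require Import structures.
From mathcomp Require Export all_boot all_order all_algebra.
From mathcomp Require Export all_classical all_reals.
From mathcomp Require Export topology normedtype.

Set Implicit Arguments.
Unset Strict Implicit.
Unset Printing Implicit Defensive.

Import Order.TTheory GRing.Theory Num.Theory.
Import numFieldNormedType.Exports.

Local Open Scope classical_set_scope.
Local Open Scope ring_scope.

(* The class of entourages over which all quantifications range. *)
Definition open_sym_entourage (X : uniformType) (U : set (X * X)) : Prop :=
  [/\ entourage U, open U & (U^-1)%relation = U].

(* Meant for n >= 1; the junk value at n = 0 is the diagonal. *)
Definition ent_pow (X : Type) (U : set (X * X)) (n : nat) : set (X * X) :=
  iter n (fun V => (V \; U)%relation) diagonal.

Definition ent_img (X : Type) (U : set (X * X)) (F : set X) : set X :=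
  [set x | exists2 y, F y & U (x, y)].

Definition ucont (R : realType) (X : uniformType) : set (X -> R) :=
  [set f | unif_continuous f].

Definition bucont (R : realType) (X : uniformType) : set (X -> R) :=
  [set f | ucont f /\ bounded_set (range f)].

(* Bourbaki boundedness, which is not metric boundedness. *)
Definition Bbounded (R : realType) (X : uniformType) (B : set X) : Prop :=
  forall f : X -> R, ucont f -> bounded_set (f @` B).

Definition uniformly_isolated (X : uniformType) (A : set X) : Prop :=
  exists2 U : set (X * X), open_sym_entourage U &
    forall x, A x -> ent_img U [set x] = [set x].

Definition uniformly_discrete (X : uniformType) (A : set X) : Prop :=
  exists2 U : set (X * X), open_sym_entourage U &
    forall x, A x -> ent_img U [set x] `&` A = [set x].

Definition proximally_continuous (R : realType) (X : uniformType)
    (f : X -> R) : Prop :=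
  forall (A : set X) (e : R), 0 < e ->
    exists2 U : set (X * X), open_sym_entourage U &
      f @` ent_img U A `<=` \bigcup_(t in f @` A) ball t e.

Definition uniformly_locally_constant_on (R : realType) (X : uniformType)
    (f : X -> R) (I : set X) : Prop :=
  exists2 U : set (X * X), open_sym_entourage U &
    forall x, I x -> f @` ent_img U [set x] = [set f x].

(* Main.v *)
(* The hard implications rest on two constructions of uniformly continuous
   functions.  If [|f|] takes arbitrarily large values at points [x n] having
   distinct neighbours [y n] at distances tending to 0, a supremum of spikes
   [g] of heights [|f (x n)|^-1] at [x n] makes [f * g] jump between [x n] and
   [y n], so (ii) fails.  If [U[C n]] is contained in [C n.+1] and the [C n]
   exhaust [X], some uniformly continuous function is at least [n] off [C n];
   hence a sequence whose [n]-th term avoids [U^n] of the previous ones is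
   Bourbaki unbounded.  Applied to pairs of close points, the latter turns a
   failure of (viii) into a failure of (vii).  For (x), the finite intersections
   of the sets [U_m^n_m[B_m]] given by (ix) decrease with [m], the [m]-th one is
   covered by a [U_m]-chain neighbourhood of one of its finite subsets, and the
   union of these finite subsets is the required [B]. *)
Require Import Defs.
From mathcomp Require Import all_boot all_order all_algebra.
From mathcomp Require Import all_classical all_reals topology normedtype.
From mathcomp Require Import ring lra.
Import Order.TTheory GRing.Theory Num.Theory.
Import numFieldNormedType.Exports.
Local Open Scope classical_set_scope.
Local Open Scope ring_scope.

(** * Metric forms of the uniform notions *)

Section MetricReformulations.
Context {R : realType} {X : metricType R}.
Implicit Types (f g : X -> R) (A B : set X) (U : set (X * X)).

Definition ball_entourage (e : R) : set (X * X) := [set p | mdist p.1 p.2 < e].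

Lemma ball_entourage_open_sym {e : R} :
  0 < e -> open_sym_entourage (ball_entourage e).
Proof.
move=> e0; split.
- rewrite -entourage_ballE; exists e => //= -[x y] /=.
  by rewrite ballEmdist.
- rewrite openE => -[a b] /= abe.
  (* Half the slack, since both coordinates of the pair may move. *)
  pose r := (e - mdist a b) / 2.
  have r0 : 0 < r by rewrite /r divr_gt0// subr_gt0.
  exists (ball a r, ball b r) => /=; first by split; exact: nbhsx_ballx.
  move=> [x y] [] /=; rewrite !ballEmdist/= => ax yb.
  have := metric_triangle x a y; have := metric_triangle a b y.
  rewrite (metric_sym x a) /ball_entourage /= /r in ax yb *.
  lra.
- by apply/seteqP; split => -[x y] /=; rewrite /ball_entourage/= metric_sym.
Qed.

Lemma entourage_ball_entourage {U} :
  entourage U -> exists2 e : R, 0 < e & ball_entourage e `<=` U.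
Proof.
rewrite -entourage_ballE => -[e /= e0 eU]; exists e => // -[x y] xy.
by apply: eU => /=; rewrite ballEmdist.
Qed.

Lemma ucontP f : ucont f <-> forall e : R, 0 < e ->
  exists2 d : R, 0 < d & forall x y, mdist x y < d -> `|f x - f y| < e.
Proof.
rewrite /ucont/= unif_continuousP; split=> fP e /fP[d d0 dP]; exists d => //.
  by move=> x y xyd; apply: (dP (x, y)); rewrite /= ballEmdist.
by move=> [x y]; rewrite ballEmdist; exact: dP.
Qed.

Lemma bounded_imageP {T : Type} (f : T -> R) (A : set T) :
  bounded_set (f @` A) <-> exists M : R, forall x, A x -> `|f x| <= M.
Proof.
split=> [[M [_ MP]]|[M MP]].
  exists (M + 1) => x Ax; apply: (MP (M + 1)); first by rewrite ltrDl.
  by exists x.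
exists M; split; first exact: num_real.
move=> y My _ [x Ax <-] /=; exact: le_trans (MP _ Ax) (ltW My).
Qed.

Lemma uniformly_isolatedP A : uniformly_isolated A <->
  exists2 d : R, 0 < d & forall x y, A x -> mdist x y < d -> y = x.
Proof.
split=> [[U [/entourage_ball_entourage[e e0 eU] _ _] UA]|[d d0 dA]].
  exists e => // x y /UA xA xy.
  suff : ent_img U [set x] y by rewrite xA.
  by exists x => //; apply: eU; rewrite /ball_entourage/= metric_sym.
exists (ball_entourage d); first exact: ball_entourage_open_sym.
move=> x Ax; apply/seteqP; split => [y [_ -> yx]|_ ->].
  by apply: (dA _ _ Ax); rewrite metric_sym.
by exists x => //; rewrite /ball_entourage/= mdistxx.
Qed.

Lemma uniformly_isolated_sub {A B} :
  A `<=` B -> uniformly_isolated B -> uniformly_isolated A.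
Proof. by move=> AB [U oU UB]; exists U => // x /AB; exact: UB. Qed.

Lemma uniformly_isolatedU {A B} :
  uniformly_isolated A -> uniformly_isolated B -> uniformly_isolated (A `|` B).
Proof.
move=> /uniformly_isolatedP[d d0 dA] /uniformly_isolatedP[e e0 eB].
apply/uniformly_isolatedP; exists (Num.min d e); first by rewrite lt_min d0.
by move=> x y; rewrite lt_min => -[/dA xy|/eB xy] /andP[? ?]; exact: xy.
Qed.

Lemma ent_pow_refl {U} n (x : X) : entourage U -> ent_pow U n (x, x).
Proof.
move=> eU; elim: n => [|n ih] //=; exists x => //=.
exact: entourage_refl.
Qed.

Lemma ent_pow_leq {U m n} : entourage U -> (m <= n)%N ->
  ent_pow U m `<=` ent_pow U n.
Proof.
move=> eU mn [x y] xy; rewrite -(subnK mn); elim: (n - m)%N => [|k ih] //=.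
exists x => //=; exact: entourage_refl.
Qed.

Lemma ent_pow_sub {U V : set (X * X)} n :
  U `<=` V -> ent_pow U n `<=` ent_pow V n.
Proof.
by move=> UV; elim: n => [|n ih] //= [x y] [z /UV xz /ih zy]; exists z.
Qed.

Lemma ent_pow_lipschitz {U f} {C : R} {n x y} :
  (forall x y, U (x, y) -> `|f x - f y| <= C) ->
  ent_pow U n (x, y) -> `|f x - f y| <= C *+ n.
Proof.
move=> UC; elim: n x => [|n ih] x.
  by rewrite /ent_pow/= /diagonal/= => ->; rewrite subrr normr0.
move=> [z /= /UC xz /ih zy].
by rewrite mulrS (le_trans (ler_distD (f z) _ _))// lerD.
Qed.

End MetricReformulations.

(* The history of the sequence is passed to [P] as a list, the length of which
   is the current index. *)
Lemma history_choice {T : Type} (P : seq T -> T -> Prop) :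
  (forall s, exists t, P s t) ->
  exists u : nat -> T, forall n, P (mkseq u n) (u n).
Proof.
move=> /choice[g gP].
pose L := fix L n := if n is n'.+1 then rcons (L n') (g (L n')) else [::].
exists (fun n => g (L n)) => n.
suff -> : mkseq (fun n => g (L n)) n = L n by [].
by elim: n => [//|n ih]; rewrite mkseqS ih.
Qed.

Lemma natr_inv_lt {R : realType} {e : R} : 0 < e ->
  exists N : nat, forall n, (N <= n)%N -> n.+1%:R^-1 < e.
Proof.
move=> e0; exists (Num.truncn e^-1) => n Nn.
rewrite invf_plt ?posrE//.
by rewrite (lt_le_trans (truncnS_gt _))// ler_nat ltnS.
Qed.
(** Transfers a common modulus of continuity from a family to its supremum. The bound [M] makes the
    supremum genuine; for empty [D] both sides use the default [sup set0 = 0]. *)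
Lemma sup_image_le_add {R : realType} {I : Type} (D : set I) (b c : I -> R)
    (M e : R) :
  (forall i, 0 <= c i <= M) -> 0 <= e -> (forall i, b i <= c i + e) ->
  sup (b @` D) <= sup (c @` D) + e.
Proof.
move=> cM e0 bc; have [->|/set0P[i Di]] := eqVneq D set0.
  by rewrite !image_set0 sup0 add0r.
apply: ge_sup; first by exists (b i), i.
move=> _ [j Dj <-]; rewrite (le_trans (bc j))// lerD2r.
apply: ub_le_sup; last by exists j.
by exists M => _ [k _ <-]; case/andP: (cM k).
Qed.

(** * Uniformly continuous functions growing along a filtration *)

Section Filtration.
Context {R : realType} {X : metricType R}.
Implicit Types (x y z : X) (A : set X).

Definition bump (z : X) (e : R) (x : X) : R := Num.max 0 (1 - mdist x z / e).

Lemma bump_ge0 z e x : 0 <= bump z e x.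
Proof. by rewrite le_max lexx. Qed.

Lemma bump_le1 z e x : 0 < e -> bump z e x <= 1.
Proof.
by move=> e0; rewrite ge_max ler01 gerBl divr_ge0 ?mdist_ge0 ?ltW.
Qed.

Lemma bump_id z e : bump z e z = 1.
Proof. by rewrite /bump mdistxx mul0r subr0 max_r ?ler01. Qed.

Lemma bump_far z e x : 0 < e -> e <= mdist x z -> bump z e x = 0.
Proof.
by move=> e0 exz; rewrite /bump max_l// subr_le0 ler_pdivlMr// mul1r.
Qed.

Lemma bump_lipschitz z e x y : 0 < e ->
  bump z e x <= bump z e y + mdist x y / e.
Proof.
move=> e0; rewrite {1}/bump ge_max; apply/andP; split.
  by rewrite addr_ge0 ?bump_ge0// divr_ge0 ?mdist_ge0 ?ltW.
have yz : 1 - mdist y z / e <= bump z e y by rewrite le_max lexx orbT.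
have : mdist y z / e <= mdist x y / e + mdist x z / e.
  by rewrite -mulrDl ler_pM2r ?invr_gt0// (metric_sym x y) metric_triangle.
by lra.
Qed.

(** For nonempty [A] this is max(0, 1 - d(x, A)/e). The default [sup set0 = 0] gives the right value
    for empty [A], which occurs below as the set preceding [C 0]. *)
Definition proximity (e : R) (A : set X) (x : X) : R :=
  sup ((fun z => bump z e x) @` A).

Lemma proximity_lipschitz e A x y : 0 < e ->
  proximity e A x <= proximity e A y + mdist x y / e.
Proof.
move=> e0; apply: (@sup_image_le_add _ _ _ _ _ 1) => [z||z].
- by rewrite bump_ge0 bump_le1.
- by rewrite divr_ge0 ?mdist_ge0 ?ltW.
- exact: bump_lipschitz.
Qed.

Lemma proximity_far e A x : 0 < e ->
  (forall z, A z -> e <= mdist x z) -> proximity e A x = 0.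
Proof.
move=> e0 Ax; have [->|/set0P[z Az]] := eqVneq A set0.
  by rewrite /proximity image_set0 sup0.
rewrite -[RHS]sup1 /proximity; congr sup; apply/seteqP; split => [_ [y Ay <-]|].
  by rewrite /= bump_far// Ax.
by move=> _ ->; exists z => //; rewrite bump_far// Ax.
Qed.

Lemma proximity_id e A x : 0 < e -> A x -> proximity e A x = 1.
Proof.
move=> e0 Ax; apply/eqP; rewrite eq_le; apply/andP; split.
  apply: ge_sup; first by exists (bump x e x), x.
  by move=> _ [z _ <-]; exact: bump_le1.
apply: ub_le_sup; last by exists x => //; rewrite bump_id.
by exists 1 => _ [z _ <-]; exact: bump_le1.
Qed.

Lemma proximity_ge0_le1 e A x : 0 < e -> 0 <= proximity e A x <= 1.
Proof.
move=> e0; have [->|/set0P[z Az]] := eqVneq A set0.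
  by rewrite /proximity image_set0 sup0 lexx ler01.
apply/andP; split; last first.
  apply: ge_sup; first by exists (bump z e x), z.
  by move=> _ [y _ <-]; exact: bump_le1.
rewrite (le_trans (bump_ge0 z e x))//; apply: ub_le_sup; last by exists z.
by exists 1 => _ [y _ <-]; exact: bump_le1.
Qed.

(* The function is the index of the first [C n] containing the point, made
   continuous by subtracting the proximity to the preceding set. *)
Lemma filtration_ucont (C : nat -> set X) (e : R) : 0 < e ->
  (forall n x y, C n x -> mdist x y < e -> C n.+1 y) ->
  (forall x, exists n, C n x) ->
  exists f : X -> R, [/\ ucont f,
    forall x y, mdist x y < e -> `|f x - f y| <= 2 &
    forall n x, ~ C n x -> n%:R <= f x].
Proof.
move=> e0 CS Cex.
have CW n x : C n x -> C n.+1 x by move=> /CS; apply; rewrite mdistxx.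
have Cle m n x : (m <= n)%N -> C m x -> C n x.
  by move=> mn Cm; rewrite -(subnK mn); elim: (n - m)%N => [//|k /CW].
have /choice[l lP] : forall x, exists n, C n x /\ forall m, C m x -> (n <= m)%N.
  move=> x; have exb : exists n, `[< C n x >].
    by have [n Cn] := Cex x; exists n; exact/asboolP.
  case: (ex_minnP exb) => n /asboolP Cn nmin; exists n; split=> // m Cm.
  by apply: nmin; exact/asboolP.
pose P n := if n is k.+1 then C k else set0.
pose f x := (l x)%:R - proximity e (P (l x)) x.
have Plt n x : P n x -> (l x < n)%N.
  by case: n => [//|n] /= Cn; rewrite ltnS; apply: (lP x).2.
have lS x y : mdist x y < e -> (l y <= (l x).+1)%N.
  by move=> xy; apply: (lP y).2; apply: CS xy; exact: (lP x).1.
have fle x y : mdist x y < e -> (l x <= l y)%N ->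
    `|f x - f y| <= 2 * (mdist x y / e).
  move=> xye lxy; have d0 : 0 <= mdist x y / e.
    by rewrite divr_ge0 ?mdist_ge0 ?ltW.
  have [lyx|lyx] := leqP (l y) (l x).
    have lE : l y = l x by apply/eqP; rewrite eqn_leq lyx.
    have := proximity_lipschitz e (P (l x)) x y e0.
    have := proximity_lipschitz e (P (l x)) y x e0.
    by rewrite /f lE (metric_sym y x) ler_norml; lra.
  (* The index jumps by one. Since [y] is at least [e] away from [P (l x)], the proximity of [x] to
     [P (l x)] is at most [mdist x y / e]; so is the defect from 1 of the proximity of [y] to
     [C (l x)]. These two errors add up to the factor 2. *)
  have lE : l y = (l x).+1 by apply/eqP; rewrite eqn_leq lyx lS.
  have px : proximity e (C (l x)) x = 1.
    by apply: proximity_id => //; exact: (lP x).1.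
  have py : proximity e (P (l x)) y = 0.
    apply: proximity_far => // z Pz; rewrite leNgt; apply/negP => yz.
    have := Plt _ _ Pz; rewrite ltnNge => /negP; apply.
    by rewrite -ltnS -lE; apply: lS; rewrite metric_sym.
  have := proximity_lipschitz e (C (l x)) x y e0.
  have := proximity_lipschitz e (P (l x)) x y e0.
  have /andP[] := proximity_ge0_le1 e (P (l x)) x e0.
  have /andP[] := proximity_ge0_le1 e (C (l x)) y e0.
  by rewrite px py /f lE /= -[in X in _ -> X]natr1 ler_norml; lra.
have flip x y : mdist x y < e -> `|f x - f y| <= 2 * (mdist x y / e).
  move=> xy; have [|/ltnW] := leqP (l x) (l y); first exact: fle.
  by rewrite distrC metric_sym; apply: fle; rewrite metric_sym.
exists f; split.
- apply/ucontP => r r0; exists (Num.min e (r * e / 2)).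
    by rewrite lt_min e0 divr_gt0// mulr_gt0.
  move=> x y; rewrite lt_min => /andP[xye xyr].
  apply: le_lt_trans (flip _ _ xye) _.
  by rewrite mulrA ltr_pdivrMr// (mulrC 2) -ltr_pdivlMr.
- move=> x y xye; apply: le_trans (flip _ _ xye) _.
  by rewrite -[leRHS]mulr1 ler_pM2l// ler_pdivrMr// mul1r ltW.
(* The index is at least [n.+1], and the subtracted proximity costs at most 1. *)
- move=> n x nCn; have nl : (n < l x)%N.
    rewrite ltnNge; apply/negP => ln; apply: nCn.
    by apply: Cle ln _; exact: (lP x).1.
  have /andP[_ p1] := proximity_ge0_le1 e (P (l x)) x e0.
  have : n.+1%:R <= (l x)%:R :> R by rewrite ler_nat.
  by rewrite /f -natr1; lra.
Qed.

(** The filtration counts the chain steps needed to reach the sequence; since [u n] avoids [C n],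
    the resulting function is at least [n] there. The bound 2 at scale [e] is kept so that a
    restricted class of functions can detect unboundedness. *)
Lemma chain_separated_unbounded {U : set (X * X)} {u : nat -> X} {e : R} :
  open_sym_entourage U -> 0 < e -> ball_entourage e `<=` U ->
  (forall i n, (i < n)%N -> ~ ent_pow U n (u n, u i)) ->
  exists f : X -> R, [/\ ucont f,
    forall x y, mdist x y < e -> `|f x - f y| <= 2 &
    ~ bounded_set (f @` range u)].
Proof.
move=> [eU _ symU] e0 beU usep.
(* The second set collects the points that no chain joins to the sequence; putting them in every
   [C n] makes the filtration exhaust the space. *)
pose C n := [set x | exists2 i, (i < n)%N & ent_pow U n (x, u i)] `|`
            [set x | forall m i, ~ ent_pow U m (x, u i)].
have [n x y Cx xy|x|f [uf fe fC]] := @filtration_ucont C e e0.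
- have Uyx : U (y, x) by apply: beU; rewrite /ball_entourage/= metric_sym.
  have Uxy : U (x, y) by exact: beU.
  case: Cx => [[i i_n xi]|Cx]; [left|right].
    by exists i; [exact: ltnW|exists x].
  by move=> m i yi; apply: (Cx m.+1 i); exists y.
- have [[m [i xi]]|nxu] := pselect (exists m i, ent_pow U m (x, u i)).
    exists (maxn m i.+1); left; exists i; first by rewrite leq_max leqnn orbT.
    by apply: (ent_pow_leq eU (leq_maxl m i.+1)); exact: xi.
  by exists 0%N; right => m i xi; apply: nxu; exists m, i.
- exists f; split=> // /bounded_imageP[M fM].
  pose n := (Num.truncn M).+1.
  have Mn : M < n%:R by exact: truncnS_gt.
  suff /fC : ~ C n (u n).
    move=> nf; have := fM _ (imageT u n).
    by rewrite leNgt (lt_le_trans Mn)// (le_trans nf)// ler_norm.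
  case => [[i i_n]|/(_ 0 n)]; first exact: usep.
  by apply; exact: ent_pow_refl.
Qed.

End Filtration.

(** * Finite bounds and uniform continuity on segments *)

Lemma seq_ubound {R : realType} {T : eqType} (g : T -> R) (s : seq T) :
  exists2 M : R, 0 <= M & forall t, t \in s -> g t <= M.
Proof.
elim: s => [|t s [M M0 MP]]; first by exists 0.
exists (Num.max M (g t)); first by rewrite le_max M0.
move=> v; rewrite in_cons => /orP[/eqP->|/MP vM].
  by rewrite le_max lexx orbT.
by rewrite le_max vM.
Qed.

Lemma pos_lower_bound {R : realType} {r : nat -> R} (N : nat) :
  (forall n, 0 < r n) ->
  exists2 d : R, 0 < d & forall n, (n < N)%N -> d <= r n.
Proof.
move=> r0; elim: N => [|N [d d0 dP]]; first by exists 1.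
exists (Num.min d (r N)); first by rewrite lt_min d0 r0.
move=> n; rewrite ltnS leq_eqVlt => /orP[/eqP->|/dP dn].
  by rewrite ge_min lexx orbT.
by rewrite ge_min dn.
Qed.

(** Heine's theorem by compactness, with only [s] confined to the segment: in the composition below,
    [f x] is known to be bounded but [f y] is not. *)
Lemma continuous_unif_segment {R : realType} {g : R -> R} (K : R) {e : R} :
  continuous g -> 0 < e -> exists2 d : R, 0 < d &
    forall s t, `|s| <= K -> `|s - t| < d -> `|g s - g t| < e.
Proof.
move=> gc e0.
have /compact_near_coveringP cK := @segment_compact R (- K) K.
have unif : \forall d \near 0^'+, forall s, s \in `[- K, K] ->
    forall t, `|s - t| < d -> `|g s - g t| < e.
  apply: (cK _ _ (fun d s : R =>
    forall t, `|s - t| < d -> `|g s - g t| < e)) => s _.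
  have e20 : 0 < e / 2 by rewrite divr_gt0.
  have /cvgrPdist_lt/(_ _ e20)[r /= r0 rP] := gc s.
  have r20 : 0 < r / 2 by rewrite divr_gt0.
  exists (ball s (r / 2), [set d : R | d < r / 2]) => /=.
    by split; [exact: nbhsx_ballx|exact: nbhs_right_lt].
  move=> [s' d] [/= ss' dr] t s't.
  have gs' := rP s' (lt_trans ss' _).
  have gt : `|g s - g t| < e / 2.
    apply: rP => /=; rewrite (le_lt_trans (ler_distD s' _ _))// (splitr r).
    by rewrite ltrD// (lt_trans s't).
  rewrite (le_lt_trans (ler_distD (g s) _ _))// (splitr e) ltrD//.
  by rewrite distrC gs'// ltr_pdivrMr// ltr_pMr// ltr1n.
have [d0 [d0P dP]] : exists d : R, 0 < d /\ forall s, s \in `[- K, K] ->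
    forall t, `|s - t| < d -> `|g s - g t| < e.
  near (0:R)^'+ => d; exists d; split; first by near: d; exact: nbhs_right_gt.
  by near: d.
exists d0 => // s t sK; apply: dP.
by rewrite in_itv/= -ler_norml.
Unshelve. all: by end_near. Qed.

(** * Products and isolation of large level sets *)

Section Implications.
Context {R : realType} {X : metricType R}.
Implicit Types (f g : X -> R) (B : set X) (U : set (X * X)).

Lemma Bbounded_seq (s : seq X) : Bbounded R [set` s].
Proof.
move=> f _; have [M _ MP] := seq_ubound (fun x => `|f x|) s.
by apply/bounded_imageP; exists M.
Qed.

Lemma ucont_proximally_continuous f : ucont f -> proximally_continuous f.
Proof.
move=> /ucontP fu A e /fu[d d0 dP].
exists (ball_entourage d); first exact: ball_entourage_open_sym.
move=> _ [y [x Ax yx] <-]; exists (f x); first by exists x.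
by apply: dP; rewrite metric_sym.
Qed.

(* The witness [g] has a spike of height [`|f (x n)|^-1] at [x n] which dies
   out before reaching [y n]. *)
Lemma isolated_of_proximal_products f : ucont f ->
  (forall g, bucont g -> proximally_continuous (f \* g)) ->
  exists2 k : R, 0 <= k & uniformly_isolated [set x | k <= `|f x|].
Proof.
move=> fu fP; apply: contrapT => nk.
have {}nk k : 0 <= k -> ~ uniformly_isolated [set x | k <= `|f x|].
  by move=> k0 ki; apply: nk; exists k.
have /ucontP/(_ 1 ltr01)[d0 d00 d0P] := fu.
(* The gap 3 exceeds the oscillation 2 of [f] over two steps shorter than [d0], so a spike around
   one [x m] cannot reach [y n] for another index [n]. *)
pose P (s : seq (X * X)) (p : X * X) :=
  [/\ forall q, q \in s -> `|f q.1| + 3 <= `|f p.1|,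
      (size s).+1%:R <= `|f p.1|, p.2 != p.1,
      mdist p.1 p.2 < (size s).+1%:R^-1 & mdist p.1 p.2 < d0].
have [s|u uP] := history_choice P.
  have [M M0 MP] := seq_ubound (fun q : X * X => `|f q.1|) s.
  (* This level forces both lower bounds on [|f|] at once; failure of isolation there supplies the
     close pair. *)
  apply: contrapT => nP; apply: (nk (M + 3 + (size s).+1%:R)).
    by rewrite !addr_ge0.
  apply/uniformly_isolatedP; exists (Num.min (size s).+1%:R^-1 d0).
    by rewrite lt_min invr_gt0 ltr0Sn.
  move=> x y /= fx; rewrite lt_min => /andP[xy1 xy2].
  apply: contrapT => /eqP yx; apply: nP; exists (x, y); split=> //=.
    move=> q /MP qM; apply: le_trans fx.
    by rewrite (le_trans (lerD qM (lexx 3)))// lerDl.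
  by apply: le_trans fx; rewrite lerDr addr_ge0.
pose x n := (u n).1; pose y n := (u n).2.
pose a n := `|f (x n)|; pose r n := mdist (x n) (y n).
have aS n : n.+1%:R <= a n by have [_] := uP n; rewrite size_mkseq.
have a1 n : 1 <= a n by rewrite (le_trans _ (aS n))// ler1n.
have a0 n : 0 < a n by rewrite (lt_le_trans ltr01).
have av1 n : (a n)^-1 <= 1 by rewrite invf_le1.
have r0 n : 0 < r n by have [_ _ + _ _] := uP n; rewrite mdist_gt0 eq_sym.
have rS n : r n < n.+1%:R^-1 by have [_ _ _ + _] := uP n; rewrite size_mkseq.
have rd n : r n < d0 by have [] := uP n.
have afar m n : (m < n)%N -> a m + 3 <= a n.
  move=> mn; have [+ _ _ _ _] := uP n; apply.
  by apply/mapP; exists m => //; rewrite mem_iota.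
pose b n z := (a n)^-1 * bump (x n) (r n) z.
pose g z := sup ((fun n => b n z) @` setT).
have b01 n z : 0 <= b n z <= 1.
  rewrite /b mulr_ge0 ?bump_ge0 ?invr_ge0 ?(ltW (a0 n))//=.
  by rewrite mulr_ile1 ?bump_ge0 ?bump_le1 ?invr_ge0// ltW.
have bg n z : b n z <= g z.
  apply: ub_le_sup; last by exists n.
  by exists 1 => _ [m _ <-]; case/andP: (b01 m z).
have g01 z : 0 <= g z <= 1.
  rewrite (le_trans _ (bg 0 z)); last by case/andP: (b01 0 z).
  apply: ge_sup; first by exists (b 0 z), 0.
  by move=> _ [m _ <-]; case/andP: (b01 m z).
have gu : ucont g.
  apply/ucontP => e e0; have e20 : 0 < e / 2 by rewrite divr_gt0.
  (* Spikes of index at least [N] have height below [e / 2]; the finitely many others are controlled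
     by their Lipschitz constants. *)
  have [N NP] := natr_inv_lt e20.
  have er0 n : 0 < e / 2 * r n by rewrite mulr_gt0.
  have [d dd0 dP] := pos_lower_bound N er0.
  have bb n z w : mdist z w < d -> b n z <= b n w + e / 2.
    move=> zw; have [/NP Nn|/dP nd] := leqP N n.
      have bn : b n z <= (a n)^-1.
        by rewrite ler_piMr ?invr_ge0 ?bump_le1// ltW.
      have an : (a n)^-1 <= n.+1%:R^-1 by rewrite lef_pV2 ?posrE.
      have /andP[bw _] := b01 n w.
      by rewrite (le_trans bn)// (le_trans an)// (le_trans (ltW Nn))// lerDr.
    have zwr : mdist z w / r n <= e / 2.
      by rewrite ler_pdivrMr// ltW// (lt_le_trans zw).
    rewrite (le_trans (ler_wpM2l _ (bump_lipschitz _ _ _ w _)))//.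
      by rewrite invr_ge0 ltW.
    rewrite mulrDr lerD2l (le_trans _ zwr)// ler_piMl//.
    by rewrite divr_ge0 ?mdist_ge0 ?ltW.
  have gle z w : mdist z w < d -> g z <= g w + e / 2.
    move=> zw; apply: (@sup_image_le_add _ _ _ _ _ 1) => [n||n].
    - exact: b01.
    - exact: ltW.
    - exact: bb.
  exists d => // z w zw; have gzw := gle _ _ zw.
  have gwz : g w <= g z + e / 2 by apply: gle; rewrite metric_sym.
  by rewrite ltr_norml; lra.
have bug : bucont g.
  split=> //; apply/bounded_imageP; exists 1 => z _.
  by have /andP[g0 g1] := g01 z; rewrite ger0_norm.
have gy n : g (y n) = 0.
  apply/eqP; rewrite eq_le; have /andP[-> _] := g01 (y n).
  rewrite andbT; apply: ge_sup; first by exists (b 0 (y n)), 0.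
  move=> _ [m _ <-]; rewrite /b/= bump_far ?mulr0// leNgt; apply/negP => ymn.
  have [mn|mn|mn] := ltngtP m n; last by move: ymn; rewrite mn metric_sym ltxx.
  - have := d0P _ _ (lt_trans ymn (rd m)).
    have := d0P _ _ (rd n); have := afar _ _ mn.
    have := ler_distD (f (y n)) (f (x n)) (f (x m)).
    have := lerB_dist (f (x n)) (f (x m)).
    by rewrite -/(a m) -/(a n); lra.
  - have := d0P _ _ (lt_trans ymn (rd m)).
    have := d0P _ _ (rd n); have := afar _ _ mn.
    have := ler_distD (f (y n)) (f (x n)) (f (x m)).
    have := lerB_dist (f (x m)) (f (x n)).
    by rewrite -/(a m) -/(a n) (distrC (f (x m))); lra.
have fgx n : 1 <= `|f (x n) * g (x n)|.
  rewrite normrM -/(a n) -ler_pdivrMl// mulr1 (le_trans _ (ler_norm _))//.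
  by rewrite (le_trans _ (bg n _))// /b bump_id mulr1.
(* On [range x] the product has modulus at least 1, yet it vanishes at the points [y n], which come
   arbitrarily close to [range x]. *)
have [U [eU _ _] UP] := fP g bug (range x) 1 ltr01.
have [d dd0 dU] := entourage_ball_entourage eU.
have [n /(_ _ (leqnn n)) nd] := natr_inv_lt dd0.
have [|_ [_ [m _ <-] <-]] := UP ((f \* g) (y n)).
  exists (y n) => //; exists (x n); first by exists n.
  by apply: dU; rewrite /ball_entourage/= metric_sym (lt_trans (rS n)).
by rewrite /ball/= gy mulr0 subr0 ltNge fgx.
Qed.

(** * Compositions and products *)

Lemma locally_constant_of_isolated f (A : set X) :
  uniformly_isolated A -> uniformly_locally_constant_on f A.
Proof. by move=> [U oU UA]; exists U => // x /UA ->; rewrite image_set1. Qed.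

(** Where [|f x|] is below [k], uniform continuity of [g] around the segment suffices; elsewhere
    [f], hence [g \o f], does not change near [x]. *)
Lemma ucont_comp_continuous {f} {g : R -> R} (k : R) : ucont f ->
  uniformly_locally_constant_on f [set x | k <= `|f x|] -> continuous g ->
  ucont (g \o f).
Proof.
move=> /ucontP fu [U [/entourage_ball_entourage[d d0 dU] _ _] UP] gc.
apply/ucontP => e e0.
have [r r0 rP] := continuous_unif_segment k gc e0.
have [c c0 cP] := fu r r0.
exists (Num.min d c); first by rewrite lt_min d0.
move=> x y; rewrite lt_min => /andP[xyd xyc] /=.
have [fxk|/ltW fxk] := leP k `|f x|; last by apply: rP => //; exact: cP.
suff -> : f y = f x by rewrite subrr normr0.
suff : (f @` ent_img U [set x]) (f y) by rewrite UP.
exists y => //; exists x => //; apply: dU.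
by rewrite /ball_entourage/= metric_sym.
Qed.

Lemma ucontD f g : ucont f -> ucont g -> ucont (f \+ g).
Proof.
move=> /ucontP fu /ucontP gu; apply/ucontP => e e0.
have e20 : 0 < e / 2 by rewrite divr_gt0.
have [c c0 cP] := fu _ e20; have [d d0 dP] := gu _ e20.
exists (Num.min c d); first by rewrite lt_min c0.
move=> x y; rewrite lt_min => /andP[/cP xc /dP xd] /=.
by rewrite opprD addrACA (le_lt_trans (ler_normD _ _))// (splitr e) ltrD.
Qed.

(** Polarization: fg is a quarter of the square of f + g minus a quarter of the square of f - g. *)
Lemma ucontM_of_comp f g :
  (forall f (h : R -> R), ucont f -> continuous h -> ucont (h \o f)) ->
  ucont f -> ucont g -> ucont (f \* g).
Proof.
move=> comp fu gu.
pose q (c t : R) := c * (t * t).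
have qc c : continuous (q c).
  by move=> t; apply: cvgM; [exact: cvg_cst|apply: cvgM; exact: cvg_id].
have -> : f \* g = (q 4^-1 \o (f \+ g)) \+ (q (- 4^-1) \o (f \+ (-%R \o g))).
  by apply/funext => x /=; rewrite /q; field.
have ngu : ucont (-%R \o g) by apply: comp => //; exact: oppr_continuous.
by apply: ucontD; (apply: comp; [exact: ucontD|exact: qc]).
Qed.

(** * Unbounded sets and complements of chain neighbourhoods *)

(** If [f] is unbounded on [B], the part of [B] where [|f|] is at least [k] cannot be finite, for
    [f] is bounded by [k] on the rest. *)
Lemma infinite_isolated_of_unbounded B :
  (forall f, ucont f ->
    exists2 k : R, 0 <= k & uniformly_isolated [set x | k <= `|f x|]) ->
  ~ Bbounded R B ->
  exists A, [/\ A `<=` B, infinite_set A & uniformly_isolated A].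
Proof.
move=> iso nB; have [f [fu nf]] : exists f, ucont f /\ ~ bounded_set (f @` B).
  apply: contrapT => nf; apply: nB => f fu; apply: contrapT => nfB.
  by apply: nf; exists f.
have [k k0 ki] := iso f fu.
exists (B `&` [set x | k <= `|f x|]); split.
- by move=> x [].
- move=> /finite_seqP[s sE]; apply: nf; apply/bounded_imageP.
  have [M M0 MP] := seq_ubound (fun x => `|f x|) s.
  exists (M + k) => x Bx; have [kx|/ltW xk] := leP k `|f x|; last first.
    by rewrite (le_trans xk)// lerDr.
  rewrite (le_trans (MP x _))// ?lerDl//.
  have : (B `&` [set x | k <= `|f x|]) x by [].
  by rewrite sE.
- exact: uniformly_isolated_sub ki.
Qed.

(** Otherwise there are ever closer pairs [x n], [y n], both avoiding chain neighbourhoods of all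
    earlier points. The set [range x] is then unbounded but contains no [y n], so it contains no
    uniform neighbourhood of an infinite subset. *)
Lemma discrete_complement_of_unbounded U :
  (forall B, ~ Bbounded R B -> exists V (A : set X),
    [/\ open_sym_entourage V, infinite_set A, A `<=` B & ent_img V A `<=` B]) ->
  open_sym_entourage U ->
  exists B n, [/\ Bbounded R B, (0 < n)%N &
    uniformly_discrete (~` ent_img (ent_pow U n) B)].
Proof.
move=> unb oU; have [eU _ _] := oU; apply: contrapT => nU.
pose P (s : seq (X * X)) (p : X * X) := [/\ p.2 != p.1,
  mdist p.1 p.2 < (size s).+1%:R^-1 &
  forall q, q \in s -> forall z, z = q.1 \/ z = q.2 ->
    ~ ent_pow U (size s).+1 (p.1, z) /\ ~ ent_pow U (size s).+1 (p.2, z)].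
have [s|u uP] := history_choice P.
  apply: contrapT => nP; apply: nU.
  (* The exponent must be positive even for the empty history. *)
  exists [set` map fst s ++ map snd s], (size s).+1; split=> //.
    exact: Bbounded_seq.
  have s0 : 0 < (size s).+1%:R^-1 :> R by rewrite invr_gt0.
  exists (ball_entourage (size s).+1%:R^-1).
    exact: ball_entourage_open_sym.
  move=> x xs; apply/seteqP; split => [y [[_ -> yx] ys]|_ ->].
    apply: contrapT => /eqP yx'; apply: nP; exists (x, y); split=> //=.
      by rewrite metric_sym.
    move=> q qs z zq.
    have zs : [set` map fst s ++ map snd s] z.
      by rewrite /= mem_cat; case: zq => ->; rewrite map_f ?orbT.
    by split=> ?; [apply: xs|apply: ys]; exists z.
  by split=> //; exists x => //; rewrite /ball_entourage/= mdistxx.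
pose x n := (u n).1; pose y n := (u n).2.
have uin i n : (i < n)%N -> u i \in mkseq u n.
  by move=> i_n; apply/mapP; exists i => //; rewrite mem_iota.
have usep i n : (i < n)%N -> ~ ent_pow U n (x n, x i).
  move=> i_n xi; have [_ _ /(_ _ (uin _ _ i_n) (x i))] := uP n.
  rewrite size_mkseq => -[|+ _]; first by left.
  by apply; exact: (ent_pow_leq eU (leqnSn n)).
have yx n m : y n <> x m.
  move=> ynm; have [nm|mn|nm] := ltngtP n m.
  - have [_ _ /(_ _ (uin _ _ nm) (y n))] := uP m.
    by case=> [|+ _]; [right|rewrite ynm; apply; exact: ent_pow_refl].
  - have [_ _ /(_ _ (uin _ _ mn) (x m))] := uP n.
    by case=> [|_ +]; [left|rewrite -ynm; apply; exact: ent_pow_refl].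
  - by have [/eqP + _ _] := uP n; apply; rewrite -/(y n) ynm nm.
have [e e0 eU'] := entourage_ball_entourage eU.
have [f [fu _ nf]] := chain_separated_unbounded oU e0 eU' usep.
have [/(_ f fu)//|V [A [[eV _ _] iA Ax VA]]] := unb (range x).
have [d d0 dV] := entourage_ball_entourage eV.
have [N NP] := natr_inv_lt d0.
(* Once [n] is at least [N], the point [y n] lies in [V[x n]]; so only terms of index below [N] can
   belong to [A]. *)
apply: iA; apply: (@sub_finite_set _ _ (x @` `I_N)); last first.
  by apply: finite_image; exact: finite_II.
move=> z Az; have [n _ nz] := Ax _ Az; exists n => //=.
rewrite ltnNge; apply/negP => /NP nd.
have [|m _ mE] := VA (y n); last exact: (yx n m).
exists z => //; apply: dV; rewrite /ball_entourage/= metric_sym -nz.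
by apply: lt_trans nd; have [_ + _] := uP n; rewrite size_mkseq.
Qed.

(** One more step of [U] creates a margin: all points close to a point outside [U^(n+1)[B]] still
    lie outside [U^n[B]], where discreteness applies. *)
Lemma isolated_complement_of_discrete U B n : open_sym_entourage U ->
  uniformly_discrete (~` ent_img (ent_pow U n) B) ->
  uniformly_isolated (~` ent_img (ent_pow U n.+1) B).
Proof.
move=> [eU _ symU] [V [eV _ _] VP]; apply/uniformly_isolatedP.
have [d d0 dU] := entourage_ball_entourage eU.
have [e e0 eV'] := entourage_ball_entourage eV.
exists (Num.min d e); first by rewrite lt_min d0.
move=> x y xn; rewrite lt_min => /andP[xyd xye].
have out z : mdist x z < d -> (~` ent_img (ent_pow U n) B) z.
  move=> xz [b Bb zb]; apply: xn; exists b => //; exists z => //.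
  exact: dU.
have : (ent_img V [set x] `&` ~` ent_img (ent_pow U n) B) y.
  split; last exact: out.
  by exists x => //; apply: eV'; rewrite /ball_entourage/= metric_sym.
by rewrite VP//; apply: out; rewrite mdistxx.
Qed.

(** * A single bounded set for all entourages *)

(** Without such a cover, a greedy choice yields a chain-separated sequence in [D], hence a function
    of the tested class unbounded on [D]. *)
Lemma finite_chain_cover {D : set X} {e : R} : 0 < e ->
  (forall f, ucont f -> (forall x y, mdist x y < e -> `|f x - f y| <= 2) ->
    bounded_set (f @` D)) ->
  exists (s : seq X) n, [set` s] `<=` D /\
    D `<=` ent_img (ent_pow (ball_entourage e) n) [set` s].
Proof.
move=> e0 bD; apply: contrapT => nD.
pose U : set (X * X) := ball_entourage e.
(* The guard is needed because every history must be extendable. If it fails, a term of [s] outside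
   [D] serves as witness, the condition being vacuous. *)
pose P (s : seq X) (x : X) := [set` s] `<=` D ->
  D x /\ forall z, z \in s -> ~ ent_pow U (size s) (x, z).
have [s|u uP] := history_choice P.
  have [sD|] := pselect ([set` s] `<=` D); last first.
    move=> nsD; apply: contrapT => nP; apply: nsD => z zs.
    apply: contrapT => nDz; apply: nP; exists z => sD.
    by case: nDz; exact: sD.
  apply: contrapT => nP; apply: nD; exists s, (size s); split=> // x Dx.
  apply: contrapT => nx; apply: nP; exists x => _; split=> // z zs xz.
  by apply: nx; exists z.
have uD n : [set` mkseq u n] `<=` D.
  elim: n => [//|n ih] z; rewrite /= mkseqS mem_rcons in_cons.
  by move=> /orP[/eqP->|/ih//]; exact: (uP n ih).1.
have usep i n : (i < n)%N -> ~ ent_pow U n (u n, u i).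
  move=> i_n; have [_ /(_ (u i))] := uP n (uD n).
  by rewrite size_mkseq; apply; apply/mapP; exists i; rewrite ?mem_iota.
have oU : open_sym_entourage U by exact: ball_entourage_open_sym.
have [//|f [fu fe nf]] := chain_separated_unbounded oU e0 _ usep.
apply: nf; have /bounded_imageP[M MP] := bD f fu fe.
apply/bounded_imageP; exists M => _ [n _ <-]; apply: MP.
exact: (uP n (uD n)).1.
Qed.

Lemma bounded_ent_img {f U} {C : R} n {B} :
  (forall x y, U (x, y) -> `|f x - f y| <= C) ->
  bounded_set (f @` B) -> bounded_set (f @` ent_img (ent_pow U n) B).
Proof.
move=> UC /bounded_imageP[M MP]; apply/bounded_imageP; exists (C *+ n + M).
move=> x [y By xy]; have := ler_normD (f x - f y) (f y); rewrite subrK.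
move=> /le_trans; apply; apply: lerD; last exact: MP.
exact: ent_pow_lipschitz UC xy.
Qed.

Lemma bounded_core :
  (forall U, open_sym_entourage U -> exists B n, [/\ Bbounded R B, (0 < n)%N &
    uniformly_isolated (~` ent_img (ent_pow U n) B)]) ->
  exists2 B, Bbounded R B & forall U, open_sym_entourage U ->
    exists2 n, (0 < n)%N & uniformly_isolated (~` ent_img (ent_pow U n) B).
Proof.
move=> iso.
pose e m : R := m.+1%:R^-1; have e0 m : 0 < e m by rewrite invr_gt0.
pose V m : set (X * X) := ball_entourage (e m).
have oV m : open_sym_entourage (V m) by exact: ball_entourage_open_sym.
(* Boundedness of [E m] is retained only against functions oscillating by at most 2 at scale [e m],
   which is what [finite_chain_cover] tests. *)
have /choice[E EP] : forall m, exists E : set X,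
    uniformly_isolated (~` E) /\ forall f, ucont f ->
      (forall x y, mdist x y < e m -> `|f x - f y| <= 2) ->
      bounded_set (f @` E).
  move=> m; have [B [n [Bb _ Bi]]] := iso _ (oV m).
  exists (ent_img (ent_pow (V m) n) B); split=> // f fu f2.
  apply: (@bounded_ent_img _ _ 2); last exact: Bb.
  by move=> x y; exact: f2.
pose D m := [set x | forall j, (j <= m)%N -> E j x].
have Di m : uniformly_isolated (~` D m).
  elim: m => [|m ih].
    apply: uniformly_isolated_sub (EP 0).1 => x nD Ex; apply: nD => j.
    by rewrite leqn0 => /eqP ->.
  apply: uniformly_isolated_sub (uniformly_isolatedU ih (EP m.+1).1) => x nD.
  have [Dm|] := pselect (D m x); last by left.
  right=> Ex; apply: nD => j; rewrite leq_eqVlt => /orP[/eqP->//|].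
  by rewrite ltnS; exact: Dm.
have /choice[F FP] : forall m, exists F : seq X, [set` F] `<=` D m /\
    exists n, D m `<=` ent_img (ent_pow (V m) n) [set` F].
  move=> m; have [||F [n [FD Fn]]] := @finite_chain_cover (D m) (e m) => //.
    move=> f fu f2; have /bounded_imageP[M MP] := (EP m).2 f fu f2.
    by apply/bounded_imageP; exists M => x Dx; apply: MP; exact: Dx.
  by exists F; split=> //; exists n.
(* For a given [f], choose [m] with [e m] below its modulus for 1. Then [f] is bounded on [D m],
   which contains [F j] for all [j] from [m] on; the earlier [F j] contribute finitely many
   points. *)
exists (\bigcup_m [set` F m]).
  move=> f fu; have /ucontP/(_ 1 ltr01)[d d0 dP] := fu.
  have [m /(_ _ (leqnn m)) md] := natr_inv_lt d0.
  have [n nP] := (FP m).2.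
  have Vf x y : V m (x, y) -> `|f x - f y| <= 1.
    by move=> xy; apply/ltW/dP; exact: lt_trans xy md.
  have /bounded_imageP[M MP] : bounded_set (f @` D m).
    have /bounded_imageP[M MP] :=
      bounded_ent_img n Vf (Bbounded_seq (F m) _ fu).
    by apply/bounded_imageP; exists M => x /nP; exact: MP.
  have [M' M'0 M'P] := seq_ubound (fun x => `|f x|) (flatten (mkseq F m)).
  apply/bounded_imageP; exists (Num.max M M') => x [j _ Fx].
  rewrite le_max; have [jm|mj] := ltnP j m.
    apply/orP; right; apply: M'P; apply/flattenP; exists (F j) => //.
    by apply/mapP; exists j; rewrite ?mem_iota.
  apply/orP; left; apply: MP => i im; have := (FP j).1 _ Fx.
  by apply; exact: leq_trans mj.
move=> U [eU _ _]; have [d d0 dU] := entourage_ball_entourage eU.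
have [m /(_ _ (leqnn m)) md] := natr_inv_lt d0.
have [n nP] := (FP m).2; exists n.+1 => //.
apply: uniformly_isolated_sub (Di m) => x nx /nP[y Fy xy]; apply: nx.
exists y; first by exists m.
apply: (ent_pow_leq eU (leqnSn n)).
apply: (ent_pow_sub n _ _ xy) => -[a b] ab; apply: dU.
exact: lt_trans ab md.
Qed.

(** A bound for [f] on [B] extends to [U^n[B]], as each chain step changes [f] by at most 1; higher
    level sets lie in the isolated complement. *)
Lemma isolated_of_bounded_core {f B} :
  Bbounded R B -> (forall U, open_sym_entourage U ->
    exists2 n, (0 < n)%N & uniformly_isolated (~` ent_img (ent_pow U n) B)) ->
  ucont f -> exists2 k : R, 0 <= k & uniformly_isolated [set x | k <= `|f x|].
Proof.
move=> Bb iso fu; have /ucontP/(_ 1 ltr01)[d d0 dP] := fu.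
have [n _ ni] := iso _ (ball_entourage_open_sym d0).
have Vf (x y : X) : ball_entourage d (x, y) -> `|f x - f y| <= 1.
  by move=> xy; exact/ltW/dP.
have /bounded_imageP[M MP] := bounded_ent_img n Vf (Bb f fu).
exists (Num.max 0 (M + 1)); first by rewrite le_max lexx.
apply: uniformly_isolated_sub ni => x /=; rewrite ge_max => /andP[_ Mx] xB.
by have := le_trans Mx (MP x xB); rewrite gerDl ler10.
Qed.

End Implications.

(** * The cycle of implications *)

Theorem theorem3p1 (R : realType) (X : metricType R) :
  [<->
   forall f g : X -> R, ucont f -> ucont g -> ucont (f \* g);
   forall f g : X -> R, ucont f -> bucont g -> proximally_continuous (f \* g);
   forall f : X -> R, ucont f ->
     exists2 k : R, 0 <= k & uniformly_isolated [set x | k <= `|f x|];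
   forall f : X -> R, ucont f ->
     exists2 k : R, 0 <= k &
       uniformly_locally_constant_on f [set x | k <= `|f x|];
   forall (f : X -> R) (g : R -> R), ucont f -> continuous g -> ucont (g \o f);
   forall B : set X, ~ Bbounded R B ->
     exists A : set X, [/\ A `<=` B, infinite_set A & uniformly_isolated A];
   forall B : set X, ~ Bbounded R B ->
     exists (U : set (X * X)) (A : set X),
       [/\ open_sym_entourage U, infinite_set A, A `<=` B & ent_img U A `<=` B];
   forall U : set (X * X), open_sym_entourage U ->
     exists (B : set X) (n : nat),
       [/\ Bbounded R B, (0 < n)%N &
           uniformly_discrete (~` ent_img (ent_pow U n) B)];
   forall U : set (X * X), open_sym_entourage U ->
     exists (B : set X) (n : nat),
       [/\ Bbounded R B, (0 < n)%N &
           uniformly_isolated (~` ent_img (ent_pow U n) B)];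
   exists2 B : set X, Bbounded R B &
     forall U : set (X * X), open_sym_entourage U ->
       exists2 n : nat, (0 < n)%N &
         uniformly_isolated (~` ent_img (ent_pow U n) B)].
Proof.
tfae.
- by move=> ring f g fu [gu _]; apply: ucont_proximally_continuous; exact: ring.
- move=> prox f fu; apply: isolated_of_proximal_products => // g.
  exact: prox.
- move=> iso f /iso[k k0 ki]; exists k => //.
  exact: locally_constant_of_isolated.
- by move=> lc f g fu; have [k _] := lc f fu; exact: ucont_comp_continuous.
(* From (v), the ring property gives (ii), then (iii), from which (vi) follows. *)
- move=> comp.
  have ring (f g : X -> R) : ucont f -> ucont g -> ucont (f \* g).
    exact: (ucontM_of_comp _ _ comp).
  move=> B; apply: infinite_isolated_of_unbounded => f fu.
  apply: isolated_of_proximal_products => // g [gu _].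
  by apply: ucont_proximally_continuous; exact: ring.
- move=> inf B /inf[A [AB iA [U oU UA]]]; exists U, A; split=> //.
  move=> x [y Ay xy]; apply: AB.
  suff : ent_img U [set y] x by rewrite UA// => ->.
  by exists y.
- by move=> unb U; exact: discrete_complement_of_unbounded.
- move=> disc U oU; have [B [n [Bb n0 nB]]] := disc U oU.
  by exists B, n.+1; split=> //; exact: isolated_complement_of_discrete.
- exact: bounded_core.
(* The cycle closes through (iii), (iv) and (v), followed by polarization. *)
- move=> [B Bb iso] f g fu gu; apply: ucontM_of_comp => // {fu gu}f h fu.
  have [k _ ki] := isolated_of_bounded_core Bb iso fu.
  by apply: ucont_comp_continuous fu _; exact: locally_constant_of_isolated ki.
Qed.
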